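(* Let $G$ be any graph. The following are equivalent: (i) $|G|_\Gamma$ and $|G|_\Theta$ are topologically equivalent. (ii) $\mathscr C^\Gamma$ and $\mathscr C^{\mathcal U}$ are $\mathscr C$-equivalent. (iii) $G$ is tough. (iv) $\Omega=\Gamma=\mathcal U$, i.e. the natural inclusions of $\Omega=\varprojlim\mathcal C_X$ into $\Gamma=\varprojlim\Gamma_X$ and into $\mathcal U=\varprojlim\mathcal U_X$ are both surjective.
   Context: Graph notation. $G=(V,E)$ is a graph, $\mathcal X$ is the set of all finite subsets of $V$, directed by inclusion; for $X\in\mathcal X$, $\mathcal C_X$ is the set of components of $G-X$, with the discrete topology; for $Y\subseteq X$, $\mathcal C_X(Y)=\{C\in\mathcal C_X\mid N(C)=Y\}$; for $X\subseteq X'$, $\mathfrak c_{X',X}\colon\mathcal C_{X'}\to\mathcal C_X$ sends each component of $G-X'$ to the component of $G-X$ including it. $V[\mathcal C]=\bigcup_{C\in\mathcal C}V(C)$. $G$ is tough if every $\mathcal C_X$ is finite. $X\in\mathcal X$ is critical if $\mathcal C_X(X)$ is infinite; $\mathrm{crit}(G)$ is the set of critical sets, $\mathrm{crit}(X)$ the set of critical subsets of $X$. For $Y\in\mathrm{crit}(G)$ with $Y\not\subseteq X$, $C_X(Y)$ is the unique component of $G-X$ meeting $Y$. A ray is a 1-way infinite path; two rays are equivalent if for every $X\in\mathcal X$ both have a tail in the same component of $G-X$; ends are equivalence classes of rays, $\Omega$ is the set of ends, $C(X,\omega)$ is the component of $G-X$ in which the rays of $\omega$ have a tail; $\omega$ is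 identified with $(C(X,\omega)\mid X\in\mathcal X)$, so $\Omega=\varprojlim\mathcal C_X$ (known, Diestel and Kühn). Topology. $G$ also denotes its 1-complex, with point set $V\sqcup\bigsqcup_{e\in E}\mathring e$, where each edge $e=xy$ is a homeomorphic copy $\{x\}\sqcup\mathring e\sqcup\{y\}$ of $[0,1]$ with $\mathring e$ corresponding to $(0,1)$; basic open neighbourhoods of points of $\mathring e$ are inherited from $(0,1)$, and those of a vertex $v$ are the unions $\bigcup_{e\ni v}[v,i_e)$ of half-open intervals with $i_e\in\mathring e$ arbitrary. For $F\subseteq E$, $\mathring F=\bigsqcup_{e\in F}\mathring e$; $E(X,\bigcup\mathcal C)$ is the set of edges between $X$ and $\bigcup\mathcal C$. $|G|_\Omega=G\sqcup\Omega$ has the topology generated by the open sets of $G$ and all sets $\bigcup\mathcal C\cup\mathring E(X,\bigcup\mathcal C)\cup\{\omega\in\Omega\mid C(X,\omega)\in\mathcal C\}$ with $X\in\mathcal X$, $\mathcal C\subseteq\mathcal C_X$. Compactifications. A compactification of a space $Y$ is a pair $(K,h)$ with $K$ compact (not necessarily Hausdorff) and $h\colon Y\to K$ an embedding with dense image. $(K,h)\le(K',h')$ if there is a continuous $f\colon K'\to K$ with $f\circ h'=h$; one writes $f\colon(K',h')\ge(K,h)$. They are topologically equivalent if some such $f$ is a homeomorphism. $\mathscr C$-systems. A $\mathscr C$-system of $G$ is an inverse system $\mathscr C^\alpha=\{(\alpha(\mathcal C_X),\alpha_X),\mathfrak a_{X',X},\mathcal X\}$ of Hausdorff compactifications of the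 discrete spaces $\mathcal C_X$, with continuous compatible bonding maps $\mathfrak a_{X',X}\colon\alpha(\mathcal C_{X'})\to\alpha(\mathcal C_X)$ satisfying $\mathfrak a_{X',X}\circ\alpha_{X'}=\alpha_X\circ\mathfrak c_{X',X}$ for all $X\subseteq X'$. Let $\mathcal I^\alpha=\varprojlim\alpha(\mathcal C_X)$, $\pi_X^\alpha\colon\mathcal I^\alpha\to\alpha(\mathcal C_X)$ the projections, and $\iota^\alpha\colon\Omega\hookrightarrow\mathcal I^\alpha$, $(C_X)_X\mapsto(\alpha_X(C_X))_X$ (the natural inclusion). $\mathscr C^\alpha$ induces the space $\alpha G=G\sqcup\mathcal I^\alpha$ with the topology generated by the open sets of $G$ and, for all $X\in\mathcal X$ and open $O\subseteq\alpha(\mathcal C_X)$, the sets $\bigcup\mathcal C\cup\mathring E(X,\bigcup\mathcal C)\cup(\pi_X^\alpha)^{-1}(O)$ where $\mathcal C=\alpha_X^{-1}(O)$; with the embedding $\mathrm{id}_G\cup\iota^\alpha$ it is a compactification of $|G|_\Omega$, and topological equivalence in (i) is as compactifications of $|G|_\Omega$. For $\mathscr C$-systems $\mathscr C^\alpha$ and $\mathscr C^\delta=\{(\delta(\mathcal C_X),\delta_X),\mathfrak d_{X',X}\}$, $\mathscr C^\alpha\le_{\mathscr C}\mathscr C^\delta$ means that for every $X\in\mathcal X$ there is $f_X\colon(\delta(\mathcal C_X),\delta_X)\ge(\alpha(\mathcal C_X),\alpha_X)$ with $f_X\circ\mathfrak d_{X',X}=\mathfrak a_{X',X}\circ f_{X'}$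 for all $X\subseteq X'$. $\mathscr C$-equivalent means that both $\mathscr C^\alpha\le_{\mathscr C}\mathscr C^\delta$ and $\mathscr C^\delta\le_{\mathscr C}\mathscr C^\alpha$. $\mathscr C^\Gamma$: $\Gamma_X=\mathcal C_X\sqcup\mathrm{crit}(X)$ with the topology generated by all subsets of $\mathcal C_X$ and the sets $\mathcal C\sqcup\{Y\}$ for $Y\in\mathrm{crit}(X)$ and $\mathcal C$ a cofinite subset of $\mathcal C_X(Y)$; $\mathfrak f_{X',X}\colon\Gamma_{X'}\to\Gamma_X$ is $\mathfrak c_{X',X}$ on $\mathcal C_{X'}$, the identity on $\mathrm{crit}(X')\cap\mathrm{crit}(X)$, and sends $Y\in\mathrm{crit}(X')\setminus\mathrm{crit}(X)$ to $C_X(Y)$. $\mathscr C^\Gamma=\{\Gamma_X,\mathfrak f_{X',X}\}$ (with inclusions $\mathcal C_X\hookrightarrow\Gamma_X$) is a $\mathscr C$-system; $\Gamma=\varprojlim\Gamma_X$, and $|G|_\Gamma=G\sqcup\Gamma$ is the compactification it induces. $\mathscr C^{\mathcal U}$: $\mathcal U_X=\beta(\mathcal C_X)$ is the Stone–Čech compactification (space of ultrafilters) of the discrete space $\mathcal C_X$, with the unique continuous extensions $\beta(\mathfrak c_{X',X})$ as bonding maps; this is a $\mathscr C$-system, $\mathcal U=\varprojlim\mathcal U_X$, and $|G|_\Theta=G\sqcup\mathcal U$ (Diestel's tangle compactification) is the compactification it induces; $\mathcal U$ is in canonical bijection with the set $\Theta$ of $\aleph_0$-tangles of $G$. *)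

(* Defs.v *)
From HB Require Import structures.
From mathcomp Require Import all_boot all_order all_algebra finmap.
From mathcomp Require Import all_classical all_reals topology.

Set Implicit Arguments.
Unset Strict Implicit.
Unset Printing Implicit Defensive.

Import Order.TTheory GRing.Theory Num.Theory.
Import numFieldTopology.Exports.
Local Open Scope classical_set_scope.
Local Open Scope ring_scope.

Definition generated_topology (T : Type) (D : set (set T)) : Type := T.

HB.instance Definition _ (T : choiceType) (D : set (set T)) :=
  Choice.on (generated_topology D).
HB.instance Definition _ (T : choiceType) (D : set (set T)) :=
  isSubBaseTopological.Build (generated_topology D) D id.

Section GeneratedTopology.
Variables (T : choiceType) (D : set (set T)).
Local Notation S := (generated_topology D).

Lemma generated_open (A : set T) : D A -> open (A : set S).
Proof.
move=> DA; exists [set A]; last by rewrite bigcup_set1.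
move=> _ ->; exists [fset A]%fset; first by move=> B /fset1P ->; exact: mem_set.
by rewrite -[[set i | i \in _]]/([set` [fset A]%fset]) set_fset1 bigcap_set1.
Qed.

Lemma generated_cvg (F : set_system T) (x : T) : Filter F ->
  (forall A, D A -> A x -> F A) -> F --> (x : S).
Proof.
move=> FF FA B; rewrite /= nbhsE => -[_ [[B' sB <-] [C B'C Cx] sUB]].
have /sB[I sI CE] := B'C.
rewrite nbhs_filterE; apply: filterS sUB _; apply: (@filterS _ _ _ C).
  by move=> y Cy; exists C.
rewrite -CE; apply: filter_bigI => E EI.
by apply: FA; [have := sI _ EI; rewrite inE|move: Cx; rewrite -CE; apply].
Qed.

End GeneratedTopology.

Section Compactifications.
Implicit Types Y K : topologicalType.

Definition is_embedding Y K (h : Y -> K) : Prop :=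
  [/\ injective h, continuous h
    & forall U, open U -> exists2 O, open O & h @` U = O `&` range h].

Definition is_compactification Y K (h : Y -> K) : Prop :=
  [/\ compact [set: K], is_embedding h & dense (range h)].

Definition is_homeomorphism K K' (f : K -> K') : Prop :=
  continuous f /\
  exists g : K' -> K, [/\ continuous g, cancel f g & cancel g f].

(* [dominates h' h f] is [f : (K', h') >= (K, h)]. *)
Definition dominates Y K K' (h' : Y -> K') (h : Y -> K) (f : K' -> K) : Prop :=
  continuous f /\ f \o h' = h.

Definition topologically_equivalent Y K K' (h : Y -> K) (h' : Y -> K') : Prop :=
  exists f : K' -> K, dominates h' h f /\ is_homeomorphism f.

End Compactifications.

Record graph := Graph {
  vertex :> choiceType;
  adj : rel vertex;
  adj_sym : symmetric adj;
  adj_irr : irreflexive adj }.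

Section Graph.
Variable G : graph.
Implicit Types (X Y : {fset G}) (u v w : G).

Definition connected_off X u v : Prop :=
  exists p : seq G,
    [/\ path (@adj G) u p, last u p = v & all (fun w => w \notin X) (u :: p)].

Definition is_component X (C : set G) : Prop :=
  exists2 u, u \notin X & C = [set v | connected_off X u v].

Record component X := Component {
  cset : set G;
  csetP : is_component X cset }.

Definition neighbours (C : set G) : set G :=
  [set v | ~ C v /\ exists2 u, C u & adj u v].

Definition components_at X Y : set (component X) :=
  [set C | neighbours (cset C) = [set` Y]].
Arguments components_at : clear implicits.

Definition tough : Prop := forall X, finite_set [set: component X].

Definition critical Y : Prop := infinite_set (components_at Y Y).

Lemma connected_off_refl X u : u \notin X -> connected_off X u u.
Proof. by move=> uX; exists [::]; split=> //=; rewrite uX. Qed.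

Lemma connected_off_trans X v u w :
  connected_off X u v -> connected_off X v w -> connected_off X u w.
Proof.
move=> [p [p1 p2 p3]] [q [q1 q2 q3]]; exists (p ++ q); split.
- by rewrite cat_path p1 p2.
- by rewrite last_cat p2.
- by rewrite -cat_cons all_cat p3; case/andP: q3.
Qed.

Lemma connected_off_edge X u v :
  adj u v -> u \notin X -> v \notin X -> connected_off X u v.
Proof. by move=> uv uX vX; exists [:: v]; rewrite /= uv uX vX. Qed.

Lemma connected_off_sym X u v : connected_off X u v -> connected_off X v u.
Proof.
move=> [p [+ + +]]; elim: p u => [|w p IH] u /=.
  by move=> _ <-; rewrite andbT => uX; exact: connected_off_refl.
move=> /andP[uw pp] lp /and3P[uX wX pX].
apply: (@connected_off_trans _ w); first by apply: IH => //=; rewrite wX.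
by apply: connected_off_edge => //; rewrite adj_sym.
Qed.

Lemma connected_offW X X' u v :
  (X `<=` X')%fset -> connected_off X' u v -> connected_off X u v.
Proof.
move=> /fsubsetP XX' [p [p1 p2 p3]]; exists p; split=> //.
by apply: sub_all p3 => w; apply: contra; exact: XX'.
Qed.

Lemma connected_offNl X u v : connected_off X u v -> u \notin X.
Proof. by move=> [p [_ _ /andP[]]]. Qed.

Lemma connected_offNr X u v : connected_off X u v -> v \notin X.
Proof. by move/connected_off_sym/connected_offNl. Qed.

Lemma component_inj X (C D : component X) : cset C = cset D -> C = D.
Proof.
case: C D => [C cC] [D cD] /= E; case: D / E cD => cD.
by rewrite (Prop_irrelevance cC cD).
Qed.

Lemma componentN X (C : component X) u : cset C u -> u \notin X.
Proof. by have [w wX ->] := csetP C => /connected_offNr. Qed.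

Lemma component_neq0 X (C : component X) : cset C !=set0.
Proof. by have [w wX ->] := csetP C; exists w; exact: connected_off_refl. Qed.

Lemma componentE X (C : component X) u v :
  cset C u -> cset C v <-> connected_off X u v.
Proof.
have [w wX ->] := csetP C => wu; split => [wv|]; last exact: connected_off_trans.
exact: connected_off_trans (connected_off_sym wu) wv.
Qed.

Lemma component_eq X (C D : component X) u : cset C u -> cset D u -> C = D.
Proof.
move=> Cu Du; apply: component_inj; apply/seteqP; split=> v.
  by move/(componentE v Cu)/(componentE v Du).
by move/(componentE v Du)/(componentE v Cu).
Qed.

Lemma component_of_subproof X u (uX : u \notin X) :
  is_component X [set v | connected_off X u v].
Proof. by exists u. Qed.

Definition component_of X u (uX : u \notin X) : component X :=
  Component (component_of_subproof uX).

Lemma component_ofP X u (uX : u \notin X) : cset (component_of uX) u.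
Proof. exact: connected_off_refl. Qed.

Lemma component_sub_ex X X' (XX' : (X `<=` X')%fset) (C' : component X') :
  exists C : component X, cset C' `<=` cset C.
Proof.
have [u uX' ->] := csetP C'.
have uX : u \notin X by apply: contra uX'; exact: (fsubsetP XX').
by exists (component_of uX) => v /=; exact: connected_offW.
Qed.

Definition component_map X X' (XX' : (X `<=` X')%fset) (C' : component X') :
  component X := projT1 (cid (component_sub_ex XX' C')).

Lemma component_map_sub X X' (XX' : (X `<=` X')%fset) (C' : component X') :
  cset C' `<=` cset (component_map XX' C').
Proof. exact: (projT2 (cid (component_sub_ex XX' C'))). Qed.

Lemma component_mapP X X' (XX' : (X `<=` X')%fset) (C' : component X')
  (C : component X) u : cset C' u -> cset C u -> component_map XX' C' = C.
Proof.
move=> C'u Cu; apply: (component_eq (u := u)) => //.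
exact: (@component_map_sub _ _ XX' C' u C'u).
Qed.

Lemma component_map_id X (XX : (X `<=` X)%fset) (C : component X) :
  component_map XX C = C.
Proof. by have [u Cu] := component_neq0 C; exact: (component_mapP XX (u := u)). Qed.

Lemma component_map_comp X X' X'' (XX' : (X `<=` X')%fset)
  (X'X'' : (X' `<=` X'')%fset) (XX'' : (X `<=` X'')%fset) (C : component X'') :
  component_map XX' (component_map X'X'' C) = component_map XX'' C.
Proof.
have [u Cu] := component_neq0 C.
apply: (@component_mapP _ _ XX' _ _ u); exact: component_map_sub.
Qed.

Lemma finite_components_meeting Y X :
  finite_set [set C : component Y | exists2 x, x \in X & cset C x].
Proof.
have -> : [set C : component Y | exists2 x, x \in X & cset C x] =
    \bigcup_(x in [set` X]) [set C : component Y | cset C x].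
  by apply/seteqP; split=> C [x xX Cx]; exists x.
apply: bigcup_finite; first exact: finite_fset.
move=> x _; have [[C Cx]|nC] := pselect (exists C : component Y, cset C x).
  apply: (sub_finite_set _ (finite_set1 C)) => D /= Dx.
  exact: component_eq Dx Cx.
by rewrite (_ : [set _ | _] = set0)// -subset0 => C Cx; apply: nC; exists C.
Qed.

Lemma component_transfer X Y Z (C : component X) :
  components_at X Y C -> (Y `<=` Z)%fset -> (forall z, z \in Z -> ~ cset C z) ->
  exists2 D : component Z, components_at Z Y D & cset D = cset C.
Proof.
move=> NC /fsubsetP YZ ZC; have [u Cu] := component_neq0 C.
have CZ w : cset C w -> w \notin Z by move=> Cw; apply/negP => /ZC.
have CE : cset C = [set v | connected_off Z u v].
  apply/seteqP; split=> v /=.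
    move=> /(componentE v Cu) [p [p1 p2 p3]]; exists p; split=> //.
    elim: p u Cu p1 {p2} p3 => [|w p IH] u Cu /=; first by rewrite CZ.
    move=> /andP[uw pp] /and3P[uX wX pX]; rewrite CZ//=.
    have Cw : cset C w by apply/(componentE w Cu); exact: connected_off_edge.
    by apply: IH => //=; rewrite wX.
  move=> [p [+ <- +]]; elim: p u Cu => [|w p IH] u Cu //=.
  move=> /andP[uw pp] /and3P[uX wX pX]; apply: IH => //; last by rewrite /= wX.
  apply: contrapT => nCw; move/negP: wX; apply; apply: YZ.
  have : neighbours (cset C) w by split=> //; exists u.
  by rewrite NC.
have cC : is_component Z (cset C) by exists u => //; exact: CZ.
by exists (Component cC).
Qed.

Lemma finite_transfer X Y Z : (Y `<=` Z)%fset ->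
  finite_set (components_at Z Y) ->
  finite_set [set C | components_at X Y C /\ forall z, z \in Z -> ~ cset C z].
Proof.
move=> YZ fin.
have : finite_set (@cset X @^-1` ((@cset Z) @` (components_at Z Y))).
  apply: finite_preimage; first by move=> C D _ _; exact: component_inj.
  exact: finite_image.
apply: sub_finite_set => C [NC ZC].
have [D ND DC] := component_transfer NC YZ ZC.
by exists D.
Qed.

Lemma critical_infinite X Y : critical Y -> (Y `<=` X)%fset ->
  infinite_set (components_at X Y).
Proof.
move=> cY YX fX; apply: cY.
apply: sub_finite_set (_ : finite_set (_ `|` _)); last first.
  rewrite finite_setU; split.
    exact: (finite_components_meeting Y X).
  exact: (@finite_transfer Y Y X YX fX).
move=> C NC.
have [?|nC] := pselect (exists2 x, x \in X & cset C x); [by left|right].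
by split=> // z zX Cz; apply: nC; exists z.
Qed.

Lemma infinite_critical X Y : (Y `<=` X)%fset ->
  infinite_set (components_at X Y) -> critical Y.
Proof.
move=> YX iX fY; apply: iX.
have := @finite_transfer X Y Y (fsubset_refl Y) fY; apply: sub_finite_set.
move=> C NC; split=> // z zY Cz.
by move: (componentN Cz); rewrite (fsubsetP YX).
Qed.

Lemma components_at_sub X Y (C : component X) :
  components_at X Y C -> (Y `<=` X)%fset.
Proof.
move=> NC; apply/fsubsetP => y yY.
have [nCy [u Cu uy]] : neighbours (cset C) y by rewrite NC.
apply: contrapT => /negP yX; apply: nCy; apply/(componentE y Cu).
by apply: connected_off_edge => //; exact: componentN Cu.
Qed.

Lemma components_atP X (C : component X) :
  exists2 Y, (Y `<=` X)%fset & components_at X Y C.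
Proof.
have sX : neighbours (cset C) `<=` [set` X].
  move=> y [nCy [u Cu uy]] /=.
  apply: contrapT => /negP yX; apply: nCy; apply/(componentE y Cu).
  by apply: connected_off_edge => //; exact: componentN Cu.
have /finite_fsetP[Y YE] : finite_set (neighbours (cset C)).
  exact: sub_finite_set sX (finite_fset X).
exists Y; last exact: YE.
by apply/fsubsetP => y yY; apply: sX; rewrite YE.
Qed.

Lemma components_at_inj X Y Y' (C : component X) :
  components_at X Y C -> components_at X Y' C -> Y = Y'.
Proof.
move=> N1 N2; have E : [set` Y] = [set` Y'] by rewrite -N1 N2.
apply/fsetP => y; apply/idP/idP => yY.
  by have : [set` Y'] y by rewrite -E.
by have : [set` Y] y by rewrite E.
Qed.

Lemma meeting_component_ex X Y : ~~ (Y `<=` X)%fset ->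
  exists C : component X, exists2 y, y \in Y & cset C y.
Proof.
move=> /fsubsetPn[y yY yX]; exists (component_of yX), y => //.
exact: component_ofP.
Qed.

(* [C_X(Y)]: a component of [G - X] meeting [Y]; it is the only one when [Y] is
   critical, by [crit_component_unique]. *)
Definition crit_component X Y (YX : ~~ (Y `<=` X)%fset) : component X :=
  projT1 (cid (meeting_component_ex YX)).

Lemma crit_componentP X Y (YX : ~~ (Y `<=` X)%fset) :
  exists2 y, y \in Y & cset (crit_component YX) y.
Proof. exact: (projT2 (cid (meeting_component_ex YX))). Qed.

Lemma crit_component_unique X Y (YX : ~~ (Y `<=` X)%fset) (C : component X) y :
  critical Y -> y \in Y -> cset C y -> crit_component YX = C.
Proof.
move=> cY yY Cy; have [z zY Dz] := crit_componentP YX.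
have [E [NE nE]] : exists E : component Y, components_at Y Y E /\
    forall x, x \in X -> ~ cset E x.
  apply: contrapT => nE; apply: cY.
  apply: sub_finite_set (finite_components_meeting Y X) => E NE /=.
  apply: contrapT => nX; apply: nE; exists E; split=> // x xX Ex.
  by apply: nX; exists x.
have nb w : w \in Y -> w \notin X ->
    exists2 u, cset E u & connected_off X w u.
  move=> wY wX; have [_ [u Eu uw]] : neighbours (cset E) w by rewrite NE.
  exists u => //; apply: connected_off_edge => //; first by rewrite adj_sym.
  by apply/negP => /nE.
have [u Eu zu] := nb _ zY (componentN Dz).
have [v Ev yv] := nb _ yY (componentN Cy).
have [F _ FE] : exists2 F : component (X `|` Y)%fset,
    components_at _ Y F & cset F = cset E.
  apply: (component_transfer NE); first exact: fsubsetUr.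
  by move=> x; rewrite inE => /orP[/nE//|xY Ex]; move: (componentN Ex); rewrite xY.
have uv : connected_off X u v.
  apply: connected_offW (fsubsetUl X Y) _.
  by apply/(componentE (C := F)); rewrite FE.
apply: (component_eq (u := z)) => //; apply/(componentE z Cy).
apply: connected_off_trans yv _.
exact: connected_off_trans (connected_off_sym uv) (connected_off_sym zu).
Qed.

End Graph.
Arguments components_at {G} X Y.

HB.instance Definition _ (G : graph) (X : {fset G}) :=
  gen_eqMixin (component X).
HB.instance Definition _ (G : graph) (X : {fset G}) :=
  gen_choiceMixin (component X).
HB.instance Definition _ (G : graph) (X : {fset G}) :=
  DiscreteTopology.copy (component X) (discrete_topology (component X)).

Record inverse_limit (G : graph) (T : {fset G} -> Type)
    (f : forall X X', (X `<=` X')%fset -> T X' -> T X) := InverseLimit {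
  coordinate : forall X, T X;
  coordinateP : forall X X' (XX' : (X `<=` X')%fset),
    f X X' XX' (coordinate X') = coordinate X }.
Arguments coordinate {G T f} _ X.

(* [cspace], [cincl] and [cbond] are [alpha(C_X)], [alpha_X] and [a_(X', X)];
   [component X] carries the discrete topology. *)
Record csystem (G : graph) := CSystem {
  cspace : {fset G} -> topologicalType;
  cincl : forall X, component X -> cspace X;
  cincl_compactification : forall X, is_compactification (cincl (X := X));
  cspace_hausdorff : forall X, hausdorff_space (cspace X);
  cbond : forall X X', (X `<=` X')%fset -> cspace X' -> cspace X;
  cbond_continuous : forall X X' (XX' : (X `<=` X')%fset),
    continuous (cbond XX');
  cbond_id : forall X (XX : (X `<=` X)%fset) x, cbond XX x = x;
  cbond_comp : forall X X' X'' (XX' : (X `<=` X')%fset)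
    (X'X'' : (X' `<=` X'')%fset) (XX'' : (X `<=` X'')%fset) x,
    cbond XX' (cbond X'X'' x) = cbond XX'' x;
  cbond_cincl : forall X X' (XX' : (X `<=` X')%fset) C,
    cbond XX' (cincl C) = cincl (component_map XX' C) }.

Arguments cspace {G} c X.
Arguments cincl {G} c {X} C.
Arguments cbond {G} c {X X'} XX' x.

Section CSystems.
Variable G : graph.
Implicit Types a d : csystem G.

Definition csystem_le a d : Prop :=
  exists f : forall X, cspace d X -> cspace a X,
    (forall X, dominates (cincl d (X := X)) (cincl a (X := X)) (f X)) /\
    forall X X' (XX' : (X `<=` X')%fset),
      f X \o cbond d XX' = cbond a XX' \o f X'.

Definition csystem_equivalent a d : Prop := csystem_le a d /\ csystem_le d a.

Definition climit a : Type := inverse_limit (@cbond G a).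

(* An end [w] is identified with the family [(C(X, w) | X)]. *)
Definition ends : Type := inverse_limit (@component_map G).

Definition end_component (X : {fset G}) (w : ends) : component X := coordinate w X.

Lemma end_incl_subproof a (w : ends) X X' (XX' : (X `<=` X')%fset) :
  cbond a XX' (cincl a (end_component X' w)) = cincl a (end_component X w).
Proof. by rewrite cbond_cincl /end_component (coordinateP w). Qed.

Definition end_incl a (w : ends) : climit a :=
  InverseLimit (@end_incl_subproof a w).

End CSystems.

Section Complex.
Variables (R : realType) (G : graph).

Local Notation unit_open := (set_type (`]0, 1[%classic : set R)).

(* An edge is a two-element vertex set. Its copy of [0, 1] needs a direction:
   [(esrc e, etgt e)] is an arbitrarily chosen listing of its two ends. *)
Record edge := Edge {
  edge_set : {fset G};
  edgeP : exists uv : G * G,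
    adj uv.1 uv.2 /\ edge_set = [fset uv.1; uv.2]%fset }.

Definition esrc (e : edge) : G := (projT1 (cid (edgeP e))).1.
Definition etgt (e : edge) : G := (projT1 (cid (edgeP e))).2.

Lemma edge_ends (e : edge) :
  adj (esrc e) (etgt e) /\ edge_set e = [fset esrc e; etgt e]%fset.
Proof. exact: (projT2 (cid (edgeP e))). Qed.

Inductive complex := Vtx of G | Inner of edge & unit_open.

Definition inner_edges (F : set edge) : set complex :=
  [set p | exists e t, F e /\ p = Inner e t].

(* The half-open interval [[v, i)] of [e]: [esrc e] is the end at 0 and [etgt e]
   the end at 1. *)
Definition half_open (v : G) (e : edge) (i : unit_open) : set complex :=
  [set p | p = Vtx v \/ exists t : unit_open, p = Inner e t /\
    ((v = esrc e /\ \val t < \val i) \/ (v = etgt e /\ \val i < \val t))].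

(* The summand [[set Vtx v]] only matters for isolated vertices. *)
Definition vertex_nbhd (v : G) (i : edge -> unit_open) : set complex :=
  [set Vtx v] `|` \bigcup_(e in [set e | v \in edge_set e]) half_open v e (i e).

Definition inner_nbhd (e : edge) (O : set unit_open) :
  set complex := Inner e @` O.

Definition complex_open : set (set complex) :=
  [set U | (forall v, U (Vtx v) -> exists i, vertex_nbhd v i `<=` U) /\
    (forall e t, U (Inner e t) ->
      exists O : set unit_open, [/\ open O, O t & inner_nbhd e O `<=` U])].

Lemma complex_openT : complex_open setT.
Proof.
split=> [v _|e t _]; last by exists setT; split=> //; exact: openT.
have t : unit_open.
  apply: (exist _ (2^-1 : R)); apply: mem_set.
  by rewrite /= in_itv /= invr_gt0 ltr0n invf_lt1 ?ltr0n// ltr1n.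
by exists (fun=> t).
Qed.

Lemma complex_openI : setI_closed complex_open.
Proof.
move=> A B [A1 A2] [B1 B2]; split.
  move=> v [/A1[i iA] /B1[j jB]].
  have /choice[m mP] e : exists m,
      half_open v e m `<=` half_open v e (i e) `&` half_open v e (j e).
    have [vs|vs] := pselect (v = esrc e).
      have nt : v <> etgt e.
        by move=> vt; have [] := edge_ends e; rewrite -vs -vt adj_irr.
      have [ij|ji] := leP (\val (i e)) (\val (j e)); [exists (i e)|exists (j e)].
        move=> p [->|[t [-> [[_ h]|[]//]]]]; first by split; left.
        split; right; exists t; split=> //; left; split=> //.
        exact: lt_le_trans ij.
      move=> p [->|[t [-> [[_ h]|[]//]]]]; first by split; left.
      split; right; exists t; split=> //; left; split=> //.
      exact: lt_trans ji.
    have [ij|ji] := leP (\val (i e)) (\val (j e)); [exists (j e)|exists (i e)].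
      move=> p [->|[t [-> [[]//|[vt h]]]]]; first by split; left.
      split; right; exists t; split=> //; right; split=> //.
      exact: le_lt_trans ij _.
    move=> p [->|[t [-> [[]//|[vt h]]]]]; first by split; left.
    split; right; exists t; split=> //; right; split=> //.
    exact: lt_trans ji _.
  exists m => p [->|[e ve]]; first by split; [apply: iA; left|apply: jB; left].
  by move/mP => [? ?]; split; [apply: iA|apply: jB]; right; exists e.
move=> e t [/A2[O [oO Ot OA]] /B2[P [oP Pt PB]]].
exists (O `&` P); split=> //; first exact: openI.
move=> _ [s [Os Ps] <-].
by split; [apply: OA|apply: PB]; exists s.
Qed.

Lemma complex_open_bigU (I : Type) (f : I -> set complex) :
  (forall i, complex_open (f i)) -> complex_open (\bigcup_i f i).
Proof.
move=> fo; split.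
  move=> v [i _ /(fo i).1[j jf]]; exists j => p /jf ?; by exists i.
move=> e t [i _ /(fo i).2[O [oO Ot Of]]]; exists O; split=> // p /Of ?.
by exists i.
Qed.

HB.instance Definition _ := gen_eqMixin complex.
HB.instance Definition _ := gen_choiceMixin complex.
HB.instance Definition _ := isOpenTopological.Build complex
  complex_openT complex_openI complex_open_bigU.

Section Tails.
Variables (X : {fset G}) (CC : set (component X)).

Definition vertex_union : set G := \bigcup_(C in CC) cset C.

Definition component_union : set complex :=
  [set Vtx v | v in vertex_union] `|`
  inner_edges [set e | exists2 C, CC C & [set` edge_set e] `<=` cset C].

Definition cut_edges : set edge :=
  [set e | exists x y, [/\ x \in X, vertex_union y &
    edge_set e = [fset x; y]%fset]].

Definition tail_union : set complex := component_union `|` inner_edges cut_edges.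

End Tails.

Definition graph_ends : Type := (complex + ends G)%type.

HB.instance Definition _ := gen_eqMixin graph_ends.
HB.instance Definition _ := gen_choiceMixin graph_ends.

Definition graph_ends_subbase : set (set graph_ends) :=
  [set inl @` U | U in @open complex] `|`
  [set W | exists X (CC : set (component X)),
    W = inl @` tail_union CC `|` inr @` [set w | CC (end_component X w)]].

HB.instance Definition _ :=
  Topological.copy graph_ends (generated_topology graph_ends_subbase).

Variable a : csystem G.

Definition compact_graph : Type := (complex + climit a)%type.

HB.instance Definition _ := gen_eqMixin compact_graph.
HB.instance Definition _ := gen_choiceMixin compact_graph.

Definition compact_graph_subbase : set (set compact_graph) :=
  [set inl @` U | U in @open complex] `|`
  [set W | exists X (O : set (cspace a X)), open O /\
    W = inl @` tail_union (cincl a (X := X) @^-1` O) `|`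
        inr @` [set x : climit a | O (coordinate x X)]].

HB.instance Definition _ :=
  Topological.copy compact_graph (generated_topology compact_graph_subbase).

Definition compact_graph_incl (p : graph_ends) : compact_graph :=
  match p with inl q => inl q | inr w => inr (end_incl a w) end.

End Complex.

Section Gamma.
Variable G : graph.
Implicit Types X Y : {fset G}.

Record crit_in X := CritIn {
  crit_set : {fset G};
  crit_sub : (crit_set `<=` X)%fset;
  crit_critical : critical crit_set }.
Arguments crit_critical {X} c.

Lemma crit_in_inj X (x y : crit_in X) : crit_set x = crit_set y -> x = y.
Proof.
case: x y => [Y sY cY] [Z sZ cZ] /= E; case: Z / E sZ cZ => sZ cZ.
by rewrite (Prop_irrelevance sY sZ) (Prop_irrelevance cY cZ).
Qed.

Definition gamma_space X : Type := (component X + crit_in X)%type.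

HB.instance Definition _ X := gen_eqMixin (gamma_space X).
HB.instance Definition _ X := gen_choiceMixin (gamma_space X).

Definition gamma_subbase X : set (set (gamma_space X)) :=
  [set inl @` A | A in [set: set (component X)]] `|`
  [set W | exists (Y : crit_in X) (CC : set (component X)),
    [/\ CC `<=` components_at X (crit_set Y),
        finite_set (components_at X (crit_set Y) `\` CC) &
        W = inl @` CC `|` [set inr Y]]].

HB.instance Definition _ X :=
  Topological.copy (gamma_space X) (generated_topology (@gamma_subbase X)).

Definition gamma_incl X (C : component X) : gamma_space X := inl C.

Definition gamma_bond X X' (XX' : (X `<=` X')%fset) (x : gamma_space X') :
    gamma_space X :=
  match x with
  | inl C => inl (component_map XX' C)
  | inr Y => match pselect (crit_set Y `<=` X)%fset with
             | left YX => inr (CritIn YX (crit_critical Y))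
             | right YX => inl (crit_component (introT negP YX))
             end
  end.

Lemma gamma_bond_in X X' (XX' : (X `<=` X')%fset) (Y : crit_in X')
  (Z : crit_in X) : crit_set Z = crit_set Y -> gamma_bond XX' (inr Y) = inr Z.
Proof.
move=> E; rewrite /gamma_bond; case: pselect => [h|]; last first.
  by move=> h; exfalso; apply: h; rewrite -E; exact: crit_sub.
by congr inr; apply: crit_in_inj; rewrite E.
Qed.

Lemma gamma_bond_out X X' (XX' : (X `<=` X')%fset) (Y : crit_in X')
  (C : component X) y : ~~ (crit_set Y `<=` X)%fset -> y \in crit_set Y ->
  cset C y -> gamma_bond XX' (inr Y) = inl C.
Proof.
move=> YX yY Cy; rewrite /gamma_bond; case: pselect => [h|h].
  by exfalso; rewrite h in YX.
by congr inl; exact: (crit_component_unique _ (crit_critical Y) yY Cy).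
Qed.

Lemma gamma_open_inl X (A : set (component X)) :
  open (inl @` A : set (gamma_space X)).
Proof. by apply: generated_open; left; exists A. Qed.

Lemma gamma_open_inr X (Y : crit_in X) (CC : set (component X)) :
  CC `<=` components_at X (crit_set Y) ->
  finite_set (components_at X (crit_set Y) `\` CC) ->
  open (inl @` CC `|` [set inr Y] : set (gamma_space X)).
Proof. by move=> ? ?; apply: generated_open; right; exists Y, CC. Qed.

Lemma gamma_cvg X (F : set_system (gamma_space X)) (x : gamma_space X) :
  Filter F -> (forall A, gamma_subbase A -> A x -> F A) -> F --> x.
Proof. exact: generated_cvg. Qed.

Definition gamma_type X (x : gamma_space X) (Y : {fset G}) : Prop :=
  match x with inl C => components_at X Y C | inr Z => crit_set Z = Y end.

Lemma gamma_compact X : compact [set: gamma_space X].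
Proof.
rewrite compact_ultra => F FU _; rewrite setTI.
apply: contrapT => nF.
have ncvg x : ~ F --> (x : gamma_space X) by move=> Fx; apply: nF; exists x.
have nF1 x : ~ F [set x].
  move=> Fx; apply: (ncvg x) => A /nbhs_singleton Ax.
  by rewrite nbhs_filterE; apply: filterS Fx => y ->.
have nFfin A : finite_set A -> ~ F A.
  move=> fA FA.
  have [x [_ /ncvg]]// : A `&` [set p | F --> (p : gamma_space X)] !=set0.
  by move: (@finite_compact (gamma_space X) _ fA); rewrite compact_ultra; exact.
have key Y : exists T, F T /\
    ((Y `<=` X)%fset -> finite_set (T `&` [set x | gamma_type x Y])).
  have [YX|nYX] := pselect (Y `<=` X)%fset; last first.
    by exists setT; split=> //; exact: filterT.
  have [cY|ncY] := pselect (critical Y); last first.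
    exists setT; split; first exact: filterT.
    move=> _; rewrite setTI.
    apply: (sub_finite_set (B := inl @` components_at X Y)).
      move=> [C|Z] /= h; first by exists C.
      by exfalso; apply: ncY; rewrite -h; exact: crit_critical.
    by apply: finite_image; apply: contrapT => inf; apply: ncY;
      exact: infinite_critical YX inf.
  pose Z := CritIn YX cY.
  have [CC [sCC fCC FCC]] : exists CC : set (component X),
    [/\ CC `<=` components_at X Y, finite_set (components_at X Y `\` CC) &
      ~ F (inl @` CC `|` [set inr Z])].
    apply: contrapT => nCC; apply: (ncvg (inr Z)); apply: gamma_cvg => A [].
      by move=> [B _ <-] [].
    move=> [Y' [CC [h1 h2 ->]]] [[]//|[E]]; subst Y'.
    by apply: contrapT => nA; apply: nCC; exists CC.
  exists (~` (inl @` CC `|` [set inr Z])); split.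
    by have [] := in_ultra_setVsetC (inl @` CC `|` [set inr Z]) FU.
  move=> _; apply: (sub_finite_set (B := inl @` (components_at X Y `\` CC))).
    move=> [C|W] [nW /= h].
      by exists C => //; split=> // CCC; apply: nW; left; exists C.
    by exfalso; apply: nW; right; congr inr; exact: crit_in_inj.
  exact: finite_image.
have /choice[T TP] := key.
pose P := fpowerset X.
have FI : F (\bigcap_(Y in [set` P]) T Y).
  by apply: filter_bigI => Y _; have [] := TP Y.
apply: nFfin FI.
apply: (sub_finite_set
  (B := \bigcup_(Y in [set` P]) (T Y `&` [set x | gamma_type x Y]))); last first.
  apply: bigcup_finite; first exact: finite_fset.
  by move=> Y /=; rewrite fpowersetE => YX; have [_] := TP Y; exact.
move=> x Tx.
have [Y YX xY] : exists2 Y, (Y `<=` X)%fset & gamma_type x Y.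
  case: x {Tx} => [C|Z]; first by have [Y] := components_atP C; exists Y.
  by exists (crit_set Z) => //; exact: crit_sub.
have YP : Y \in P by rewrite fpowersetE.
by exists Y => //; split=> //; exact: Tx.
Qed.

Lemma gamma_hausdorff X : hausdorff_space (gamma_space X).
Proof.
pose sep (x y : gamma_space X) := exists A B : set (gamma_space X),
  [/\ A x, B y, open A, open B & A `&` B = set0].
have sepC x y : sep x y -> sep y x.
  by move=> [A [B [? ? ? ? AB]]]; exists B, A; split=> //; rewrite setIC.
suff H : forall x y, x <> y -> sep x y.
  move=> x y xy; apply: contrapT => /H[A [B [Ax By oA oB AB]]].
  have [] := xy A B; [exact: open_nbhs_nbhs|exact: open_nbhs_nbhs|].
  by move=> z; rewrite AB.
have Hl C z : inl C <> z -> sep (inl C) z.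
  move=> Cz; exists (inl @` [set C]), (~` (inl @` [set C])); split.
  - by exists C.
  - by move=> [_ -> /Cz].
  - exact: gamma_open_inl.
  - rewrite openE => w nw; case: w nw => [D|Y] nw.
      apply: (@filterS _ _ _ (inl @` [set D] : set (gamma_space X))).
        by move=> _ [_ -> <-].
      apply: open_nbhs_nbhs; split; first exact: gamma_open_inl.
      by exists D.
    apply: (@filterS _ _ _ (inl @` (components_at X (crit_set Y) `\ C) `|`
        [set inr Y] : set (gamma_space X))).
      by move=> _ [[D [_ DC] <-]|-> []//] [_ -> [E]]; apply: DC.
    apply: open_nbhs_nbhs; split; last by right.
    apply: gamma_open_inr; first by move=> D [].
    apply: (sub_finite_set (B := [set C])); last exact: finite_set1.
    by move=> D [ND nD]; apply: contrapT => DC; apply: nD.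
  - exact: setICr.
have Hr (Y Z : crit_in X) : Y <> Z -> sep (inr Y) (inr Z).
  move=> YZ; exists (inl @` components_at X (crit_set Y) `|` [set inr Y]),
    (inl @` components_at X (crit_set Z) `|` [set inr Z]).
  split; [by right|by right| | |].
  - by apply: gamma_open_inr => //; rewrite setDv; exact: finite_set0.
  - by apply: gamma_open_inr => //; rewrite setDv; exact: finite_set0.
  rewrite -subset0 => w [[[C CY <-]|->] [[D DZ E]|E]].
  - case: E => E; rewrite E in DZ; apply: YZ; apply: crit_in_inj.
    exact: components_at_inj CY DZ.
  - by [].
  - by [].
  - by apply: YZ; case: E.
move=> [C|Y] [D|Z] xy.
- exact: Hl.
- exact: Hl.
- by apply: sepC; apply: Hl; exact/nesym.
- by apply: Hr => YZ; apply: xy; rewrite YZ.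
Qed.

Lemma gamma_incl_compactification X :
  is_compactification (@gamma_incl X).
Proof.
split; first exact: gamma_compact.
  split.
  - by move=> C D [].
  - apply/continuousP => A _; exact: discrete_open.
  - move=> U _; exists (inl @` U); first exact: gamma_open_inl.
    by apply/seteqP; split=> [_ [C UC <-]|_ [[C UC <-] _]]; [split; exists C|exists C].
move=> O [x Ox] oO; case: x Ox => [C OC|Y OY]; first by exists (inl C); split=> //; exists C.
pose F : set_system (gamma_space X) :=
  [set A | finite_set (components_at X (crit_set Y) `\` (inl @^-1` A))].
have FF : Filter F.
  split=> [|A B FA FB|A B AB FA].
  - by rewrite /F/= preimage_setT setDT; exact: finite_set0.
  - by rewrite /F/= preimage_setI setDIr finite_setU.
  - by apply: sub_finite_set FA => C [NC nB]; split=> // AC; apply/nB/AB.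
have FY : F --> (inr Y : gamma_space X).
  apply: gamma_cvg => A [[B _ <-] []//|[Z [CC [sCC fCC ->]]]] [[]//|[YZ]].
  subst Z; apply: sub_finite_set fCC => C [NC nA]; split=> // CCC.
  by apply: nA; left; exists C.
have FO : F O by apply: FY; exact: open_nbhs_nbhs.
apply: contrapT => nO.
apply: (critical_infinite (crit_critical Y) (crit_sub Y)).
apply: sub_finite_set FO => C NC; split=> // OC; apply: nO.
by exists (inl C); split=> //; exists C.
Qed.

Lemma gamma_bond_continuous X X' (XX' : (X `<=` X')%fset) :
  continuous (gamma_bond XX').
Proof.
move=> x; have FF := fmap_filter (gamma_bond XX') (nbhs_filter x).
apply: gamma_cvg => A sA Afx; change (nbhs x (gamma_bond XX' @^-1` A)).
clear FF.
case: x Afx => [C AC|Y AY].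
  suff : nbhs (inl C : gamma_space X') (inl @` [set C]).
    by apply: filterS => _ [_ -> <-].
  apply: open_nbhs_nbhs; split; first exact: gamma_open_inl.
  by exists C.
have [YX|YX] := boolP (crit_set Y `<=` X)%fset.
  pose Z := CritIn YX (crit_critical Y).
  have fY : gamma_bond XX' (inr Y) = inr Z by exact: gamma_bond_in.
  rewrite fY in AY; case: sA => [[B _ BA]|]; first by move: AY; rewrite -BA => -[].
  move=> [Z' [CC [sCC fCC AE]]]; move: AY; rewrite AE => -[[]//|[ZZ']].
  subst Z'.
  pose DD := components_at X' (crit_set Y) `&` (component_map XX' @^-1` CC).
  suff : nbhs (inr Y : gamma_space X') (inl @` DD `|` [set inr Y]).
    apply: filterS => _ [[D [_ CCD] <-]|->].
      by left; exists (component_map XX' D).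
    by rewrite /preimage/= -/(gamma_bond XX' (inr Y)) fY; right.
  apply: open_nbhs_nbhs; split; last by right.
  apply: gamma_open_inr; first by move=> D [].
  have tr D : components_at X' (crit_set Y) D ->
      components_at X (crit_set Y) (component_map XX' D) /\
      cset (component_map XX' D) = cset D.
    move=> ND; have [E NE EE] := component_transfer ND YX
      (fun z zX Dz => negP (componentN Dz) (fsubsetP XX' _ zX)).
    have [u Du] := component_neq0 D.
    suff -> : component_map XX' D = E by [].
    by apply: (component_mapP XX' (u := u)) => //; rewrite EE.
  have : finite_set (component_map XX' @^-1` (components_at X (crit_set Z) `\` CC)
      `&` components_at X' (crit_set Y)).
    apply: (sub_finite_set (B := @cset G X' @^-1`
      (@cset G X @` (components_at X (crit_set Z) `\` CC)))).
      by move=> D [[nD NE] ND]; exists (component_map XX' D) => //; exact: (tr D ND).2.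
    apply: finite_preimage; first by move=> D E _ _; exact: component_inj.
    exact: finite_image.
  apply: sub_finite_set => D [ND nD]; split=> //; split; first by have [] := tr D ND.
  by move=> CCD; apply: nD.
have [y yY Dy] := crit_componentP YX.
have fY : gamma_bond XX' (inr Y) = inl (crit_component YX).
  exact: gamma_bond_out YX yY Dy.
rewrite fY in AY.
suff : nbhs (inr Y : gamma_space X')
    (inl @` components_at X' (crit_set Y) `|` [set inr Y]).
  apply: filterS => _ [[D ND <-]|->]; last by rewrite /preimage/= -/(gamma_bond XX' (inr Y)) fY.
  rewrite /preimage/= (_ : component_map XX' D = crit_component YX)//.
  have [nDy [u Du uy]] : neighbours (cset D) y by rewrite ND.
  apply: (component_mapP XX' (u := u)) => //.
  apply/(componentE u Dy); apply: connected_off_edge; first by rewrite adj_sym.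
    exact: componentN Dy.
  by apply: contra (componentN Du); exact: (fsubsetP XX').
apply: open_nbhs_nbhs; split; last by right.
by apply: gamma_open_inr => //; rewrite setDv; exact: finite_set0.
Qed.

Lemma gamma_bond_id X (XX : (X `<=` X)%fset) x : gamma_bond XX x = x.
Proof.
case: x => [C|Y]; first by rewrite /= component_map_id.
exact: gamma_bond_in.
Qed.

Lemma gamma_bond_comp X X' X'' (XX' : (X `<=` X')%fset)
    (X'X'' : (X' `<=` X'')%fset) (XX'' : (X `<=` X'')%fset) x :
  gamma_bond XX' (gamma_bond X'X'' x) = gamma_bond XX'' x.
Proof.
case: x => [C|Y].
  by rewrite /= (component_map_comp XX' X'X'' XX'').
have [YX'|YX'] := boolP (crit_set Y `<=` X')%fset.
  pose Z := CritIn YX' (crit_critical Y).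
  rewrite (gamma_bond_in X'X'' (Y := Y) (Z := Z) erefl).
  have [YX|YX] := boolP (crit_set Y `<=` X)%fset.
    pose W := CritIn YX (crit_critical Y).
    by rewrite (gamma_bond_in XX' (Z := W))// (gamma_bond_in XX'' (Z := W)).
  have [y yY Dy] := crit_componentP YX.
  rewrite (gamma_bond_out XX' (Y := Z) YX yY Dy).
  by rewrite (gamma_bond_out XX'' YX yY Dy).
have YX : ~~ (crit_set Y `<=` X)%fset.
  by apply: contra YX' => YX; exact: fsubset_trans YX XX'.
have [y yY Dy] := crit_componentP YX'.
rewrite (gamma_bond_out X'X'' YX' yY Dy) /= -/(gamma_bond XX'' (inr Y)).
by rewrite (gamma_bond_out XX'' YX yY (component_map_sub XX' Dy)).
Qed.

Definition gamma_system : csystem G :=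
  CSystem gamma_incl_compactification gamma_hausdorff gamma_bond_continuous
    gamma_bond_id gamma_bond_comp (fun _ _ _ _ => erefl).

End Gamma.

Section StoneCech.

Record ultrafilter_on (T : Type) := UltrafilterOn {
  uset : set_system T;
  usetP : UltraFilter uset }.

Section UltrafilterSpace.
Variable T : Type.
Local Notation beta := (ultrafilter_on T).

HB.instance Definition _ := gen_eqMixin beta.
HB.instance Definition _ := gen_choiceMixin beta.

Definition beta_basic (A : set T) : set beta := [set u | uset u A].

Lemma ultra_proper_uset (u : beta) : ProperFilter (uset u).
Proof. exact: (@ultra_proper _ _ (usetP u)). Qed.

Lemma uset_inj (u v : beta) : uset u = uset v -> u = v.
Proof.
case: u v => [F FU] [F' FU'] /= E; case: F' / E FU' => FU'.
by rewrite (Prop_irrelevance FU FU').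
Qed.

Lemma ultraP (F : set_system T) : ProperFilter F ->
  (forall A, F A \/ F (~` A)) -> UltraFilter F.
Proof.
move=> FF Fdec; split=> // H HF FH; apply/seteqP; split=> // A HA.
have [//|/FH HnA] := Fdec A.
by have /filter_ex[x [Ax []]] : H (A `&` ~` A) by exact: filterI.
Qed.

Lemma uset_setC (u : beta) A : uset u (~` A) <-> ~ uset u A.
Proof.
have FP := ultra_proper_uset u.
split=> [nA uA|nA]; last by have [] := @in_ultra_setVsetC _ _ A (usetP u).
by have /filter_ex[x [Ax []]] : uset u (A `&` ~` A) by exact: filterI.
Qed.

Lemma beta_basic_cover : \bigcup_(A in [set: set T]) beta_basic A = setT.
Proof.
rewrite -subTset => u _; exists setT => //.
by have FP := ultra_proper_uset u; exact: filterT.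
Qed.

Lemma beta_basic_join A B (u : beta) : [set: set T] A -> [set: set T] B ->
  beta_basic A u -> beta_basic B u ->
  exists C, [/\ [set: set T] C, beta_basic C u &
    beta_basic C `<=` beta_basic A `&` beta_basic B].
Proof.
move=> _ _ uA uB; exists (A `&` B); split=> //.
  by have FP := ultra_proper_uset u; exact: filterI.
move=> v vAB; have FP := ultra_proper_uset v.
by split; apply: filterS vAB => x [].
Qed.

HB.instance Definition _ :=
  isBaseTopological.Build beta beta_basic_cover beta_basic_join.

Lemma beta_basic_open A : open (beta_basic A).
Proof. by exists [set A] => //; rewrite bigcup_set1. Qed.

Lemma beta_cvg (F : set_system beta) (u : beta) : Filter F ->
  (forall A, uset u A -> F (beta_basic A)) -> F --> u.
Proof.
move=> FF FA B; rewrite /= nbhsE => -[_ [[D _ <-] [A DA uA]] sDB].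
rewrite nbhs_filterE; apply: filterS sDB _.
by apply: filterS (FA _ uA) => v vA; exists A.
Qed.

Lemma beta_compact : compact [set: beta].
Proof.
rewrite compact_ultra => F FU _; rewrite setTI.
have FP : ProperFilter F := @ultra_proper _ _ FU.
pose P : set_system T := [set A | F (beta_basic A)].
have PP : ProperFilter P.
  apply: Build_ProperFilter_ex.
    move=> A FA; have [u uA] := @filter_ex _ _ FP _ FA.
    by have [x Ax] := @filter_ex _ _ (ultra_proper_uset u) _ uA; exists x.
  split.
  - rewrite /P/= (_ : beta_basic setT = setT); first exact: filterT.
    rewrite -subTset => u _.
    by have uP := ultra_proper_uset u; exact: filterT.
  - move=> A B PA PB; have := @filterI _ F FP _ _ PA PB.
    rewrite /P /=; apply: (@filterS _ F FP) => u [uA uB].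
    by have uP := ultra_proper_uset u; exact: (@filterI _ (uset u) uP).
  - move=> A B AB; rewrite /P /=; apply: (@filterS _ F FP) => u.
    by have uP := ultra_proper_uset u; exact: (@filterS _ (uset u) uP).
have PU : UltraFilter P.
  apply: ultraP => A; have [|FA] := in_ultra_setVsetC (beta_basic A) FU.
    by left.
  by right; move: FA; apply: (@filterS _ F FP) => u; rewrite /beta_basic /= uset_setC.
by exists (UltrafilterOn PU); apply: beta_cvg.
Qed.

Lemma beta_hausdorff : hausdorff_space beta.
Proof.
move=> u v uv; apply: uset_inj; apply/seteqP; split=> A.
  move=> uA; apply: contrapT => /uset_setC vA.
  have [||w [wA /uset_setC //]] := uv (beta_basic A) (beta_basic (~` A));
    by apply: open_nbhs_nbhs; split=> //; exact: beta_basic_open.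
move=> vA; apply: contrapT => /uset_setC uA.
have [||w [/uset_setC //]] := uv (beta_basic (~` A)) (beta_basic A);
  by apply: open_nbhs_nbhs; split=> //; exact: beta_basic_open.
Qed.

Definition beta_incl (x : T) : beta :=
  UltrafilterOn (principal_filter_ultra x).

Lemma beta_inclE x A : uset (beta_incl x) A <-> A x.
Proof. by split=> /principal_filterP. Qed.

Lemma beta_incl_dense (O : set beta) : O !=set0 -> open O ->
  exists x, O (beta_incl x).
Proof.
move=> [u Ou] oO; have : nbhs u O by exact: open_nbhs_nbhs.
rewrite nbhsE => -[_ [[D _ <-] [A DA uA]] sDO].
have uP := ultra_proper_uset u; have [x Ax] := @filter_ex _ _ uP _ uA.
by exists x; apply: sDO; exists A => //; apply/beta_inclE.
Qed.

End UltrafilterSpace.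

Section BetaMap.
Variables (S T : Type) (f : S -> T).

Lemma beta_map_subproof (u : ultrafilter_on S) : UltraFilter (f @ uset u).
Proof.
have uP := ultra_proper_uset u.
by apply: ultraP => A; exact: (@in_ultra_setVsetC _ _ (f @^-1` A) (usetP u)).
Qed.

Definition beta_map (u : ultrafilter_on S) : ultrafilter_on T :=
  UltrafilterOn (beta_map_subproof u).

Lemma beta_map_continuous : continuous beta_map.
Proof.
move=> u; have FF := fmap_filter beta_map (nbhs_filter u).
apply: beta_cvg => A uA.
apply: (@open_nbhs_nbhs _ u (beta_basic (f @^-1` A))).
by split=> //; exact: beta_basic_open.
Qed.

Lemma beta_map_incl x : beta_map (beta_incl x) = beta_incl (f x).
Proof.
apply: uset_inj; apply/seteqP; split=> A.
  by move=> /beta_inclE ?; apply/beta_inclE.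
by move=> /beta_inclE ?; apply/beta_inclE.
Qed.

(* [beta_map f] is the only continuous extension of [f]. *)
Lemma beta_map_unique (g : ultrafilter_on S -> ultrafilter_on T) :
  continuous g -> (forall x, g (beta_incl x) = beta_incl (f x)) -> g = beta_map.
Proof.
move=> cg gf; apply/funext => u; apply: beta_hausdorff => A B /cg gA fB.
have fB' := beta_map_continuous fB.
have : nbhs u (g @^-1` A `&` beta_map @^-1` B) by exact: filterI.
rewrite nbhsE => -[O [oO Ou] sO].
have [x Ox] := beta_incl_dense (ex_intro _ u Ou) oO.
have [Ax Bx] := sO _ Ox; exists (g (beta_incl x)); split=> //.
by rewrite gf -beta_map_incl.
Qed.

End BetaMap.

Variable G : graph.
Implicit Types X : {fset G}.

Definition ultra_space X : topologicalType := ultrafilter_on (component X).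

Definition ultra_incl X (C : component X) : ultra_space X := beta_incl C.

Lemma ultra_incl_compactification X : is_compactification (@ultra_incl X).
Proof.
split; first exact: beta_compact.
  split.
  - move=> C D E; have /beta_inclE// : uset (beta_incl D) [set C].
    by rewrite -[beta_incl D]E; apply/beta_inclE.
  - by apply/continuousP => A _; exact: discrete_open.
  - move=> U _; exists (beta_basic U); first exact: beta_basic_open.
    apply/seteqP; split=> [_ [C UC <-]|u [UC [C _ E]]].
      by split; [apply/beta_inclE|exists C].
    by exists C => //; move: UC; rewrite -E => /beta_inclE.
move=> O On0 oO; have [C OC] := beta_incl_dense On0 oO.
by exists (ultra_incl C); split=> //; exists C.
Qed.

Lemma ultra_hausdorff X : hausdorff_space (ultra_space X).
Proof. exact: beta_hausdorff. Qed.

Definition ultra_bond X X' (XX' : (X `<=` X')%fset) :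
  ultra_space X' -> ultra_space X := beta_map (component_map XX').

Lemma ultra_bond_continuous X X' (XX' : (X `<=` X')%fset) :
  continuous (ultra_bond XX').
Proof. exact: beta_map_continuous. Qed.

Lemma ultra_bond_id X (XX : (X `<=` X)%fset) x : ultra_bond XX x = x.
Proof.
apply: uset_inj; apply/funext => A.
change (uset x (component_map XX @^-1` A) = uset x A); congr (uset x _).
by apply/funext => C; rewrite /preimage/= component_map_id.
Qed.

Lemma ultra_bond_comp X X' X'' (XX' : (X `<=` X')%fset)
    (X'X'' : (X' `<=` X'')%fset) (XX'' : (X `<=` X'')%fset) x :
  ultra_bond XX' (ultra_bond X'X'' x) = ultra_bond XX'' x.
Proof.
apply: uset_inj; apply/funext => A.
change (uset x (component_map X'X'' @^-1` (component_map XX' @^-1` A)) =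
  uset x (component_map XX'' @^-1` A)); congr (uset x _).
by apply/funext => C; rewrite /preimage/= (component_map_comp XX' X'X'' XX'').
Qed.

Definition ultra_system : csystem G :=
  CSystem ultra_incl_compactification ultra_hausdorff ultra_bond_continuous
    ultra_bond_id ultra_bond_comp
    (fun _ _ XX' C => beta_map_incl (component_map XX') C).

End StoneCech.

(* Main.v *)
(** If [G] is tough, each [C_X] is finite, so every Hausdorff compactification
    of it adds no point: all [C]-systems are equivalent and their limits are the
    space of ends. If [G] is not tough, some finite [Y] is critical, and [Y]
    defines a point of [Gamma] that is not an end. Splitting the infinite set
    [C_Y(Y)] into two infinite parts, the vertices of either part accumulate at
    this point; no point of [|G|_Theta] can play its role, as an ultrafilter on
    [C_Y] contains only one of two disjoint sets. Finally, equivalence of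
    [C]-systems passes to the induced compactifications by functoriality. *)

Require Import Defs.
From mathcomp Require Import all_boot all_order all_algebra finmap.
From mathcomp Require Import all_classical all_reals topology.

Set Implicit Arguments.
Unset Strict Implicit.
Unset Printing Implicit Defensive.

Local Open Scope classical_set_scope.

(** * Dense subsets, finite spaces and infinite sets *)

Lemma eq_on_dense (T U : topologicalType) (S : set T) (f g : T -> U) :
  hausdorff_space U -> dense S -> continuous f -> continuous g ->
  {in S, f =1 g} -> f = g.
Proof.
move=> hU dS cf cg fg; apply/funext => x; apply: hU => A B /cf fA /cg gB.
have : nbhs x (f @^-1` A `&` g @^-1` B) by exact: filterI.
rewrite nbhsE => -[O [oO Ox] sO].
have [y [/sO[Ay By] Sy]] := dS O (ex_intro _ x Ox) oO.
by exists (f y); split=> //; rewrite fg//; exact: mem_set.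
Qed.

(** A finite range is compact, hence closed in the Hausdorff space [K]; being dense as well, it is
    everything. *)
Lemma finite_compactification_surj (Y K : topologicalType) (h : Y -> K) :
  hausdorff_space K -> is_compactification h -> finite_set [set: Y] ->
  range h = [set: K].
Proof.
move=> hK [_ _ dh] fY; apply: contrapT => nh.
have ch : closed (range h).
  exact: compact_closed hK (finite_compact (finite_image h fY)).
have [||x [nx hx]] := dh (~` range h).
- by apply/set0P/negP => /eqP /(congr1 (@setC _)); rewrite setCK setC0.
- exact: closed_openC.
- exact: nx.
Qed.

(** Take the even and the odd terms of an injective sequence in [S]. *)
Lemma infinite_split (T : Type) (S : set T) : infinite_set S ->
  exists A B : set T, [/\ A `<=` S, B `<=` S, infinite_set A, infinite_set B &
    A `&` B = set0].
Proof.
move=> /infiniteP/card_leP[f].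
pose g (n : nat) : T := \val (f (SigSub (mem_set (I : [set: nat] n)))).
have gI : injective g.
  by move=> m n /val_inj /inj; rewrite !inE => /(_ I I) [].
have gS n : S (g n) by exact: set_valP.
have infg (h : nat -> nat) : injective h -> infinite_set (range (g \o h)).
  move=> hI /(@finite_preimage _ _ _ (g \o h)) fin; apply: infinite_nat.
  rewrite (_ : setT = (g \o h) @^-1` range (g \o h)).
    by apply: fin => m n _ _ /gI /hI.
  by apply/esym; rewrite -subTset => n _; exists n.
exists (range (g \o double)), (range (g \o (fun n => n.*2.+1))); split.
- by move=> _ [n _ <-]; exact: gS.
- by move=> _ [n _ <-]; exact: gS.
- by apply: infg; exact: double_inj.
- by apply: infg => m n [] /double_inj.
rewrite -subset0 => _ [[m _ <-] [n _ /gI /(congr1 odd)]].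
by rewrite /= !odd_double.
Qed.

(** * Comparing systems of compactifications *)

Section CSystemMorphisms.
Variable G : graph.
Implicit Types a d : csystem G.

Lemma cincl_inj a (X : {fset G}) : injective (@cincl G a X).
Proof. by have [_ []] := @cincl_compactification G a X. Qed.

Lemma inverse_limit_inj (T : {fset G} -> Type)
    (f : forall X X', (X `<=` X')%fset -> T X' -> T X)
    (x y : inverse_limit f) :
  (forall X, coordinate x X = coordinate y X) -> x = y.
Proof.
case: x y => [x xP] [y yP] /= xy.
have E : x = y by apply/functional_extensionality_dep => X; exact: xy.
by case: y / E yP {xy} => yP; rewrite (Prop_irrelevance xP yP).
Qed.

(** * Tough graphs *)

Section Tough.
Hypothesis tG : tough G.

Lemma tough_cincl_surj a (X : {fset G}) (x : cspace a X) :
  exists C, cincl a C = x.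
Proof.
have E := finite_compactification_surj (@cspace_hausdorff G a X)
  (@cincl_compactification G a X) (tG X).
by have [C _ <-] : range (@cincl G a X) x; [rewrite E|exists C].
Qed.

(** [cincl a] embeds a discrete space, so some open set meets its range in [x] alone, and the range
    is the whole space. *)
Lemma tough_cspace_discrete a (X : {fset G}) (x : cspace a X) :
  nbhs x [set x].
Proof.
have [C <-] := tough_cincl_surj x.
have [_ [_ _ emb] _] := @cincl_compactification G a X.
have [O oO OE] := emb [set C] (discrete_open _).
have OC D : O (cincl a D) -> D = C.
  move=> OD; have : (O `&` range (@cincl G a X)) (cincl a D) by split=> //; exists D.
  by rewrite -OE => -[_ -> /cincl_inj].
apply: (@filterS _ _ _ O).
  by move=> y; have [D <-] := tough_cincl_surj y => /OC ->.
apply: open_nbhs_nbhs; split=> //.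
have : (O `&` range (@cincl G a X)) (cincl a C) by rewrite -OE; exists C.
by case.
Qed.

(** The map required at [X] is the inverse of [cincl d] followed by [cincl a]; it is continuous
    because [cspace d X] is discrete. *)
Lemma tough_csystem_le a d : csystem_le a d.
Proof.
pose f X (x : cspace d X) := projT1 (cid (tough_cincl_surj x)).
have fP X (x : cspace d X) : cincl d (f X x) = x.
  exact: projT2 (cid (tough_cincl_surj x)).
have fK X (C : component X) : f X (cincl d C) = C.
  by apply: (@cincl_inj d); exact: fP.
exists (fun X x => cincl a (f X x)); split.
  move=> X; split; last by apply/funext => C /=; rewrite fK.
  move=> x A /nbhs_singleton Ax.
  by apply: filterS (tough_cspace_discrete x) => y ->.
move=> X X' XX'; apply/funext => x /=.
by rewrite -(fP X' x) !fK !cbond_cincl fK.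
Qed.

(** Each coordinate of a limit point is a component, and these components are compatible because
    [cincl a] is injective and commutes with the bonding maps. *)
Lemma tough_end_incl_surj a : range (end_incl a) = [set: climit a].
Proof.
rewrite -subTset => x _.
pose c X := projT1 (cid (tough_cincl_surj (coordinate x X))).
have cP X : cincl a (c X) = coordinate x X.
  exact: projT2 (cid (tough_cincl_surj (coordinate x X))).
have cE X X' (XX' : (X `<=` X')%fset) : component_map XX' (c X') = c X.
  by apply: (@cincl_inj a); rewrite -cbond_cincl !cP (coordinateP x).
by exists (InverseLimit cE) => //; apply: inverse_limit_inj => X; exact: cP.
Qed.

End Tough.

(** * From systems to the compactifications they induce *)

Section Functoriality.
Variable R : realType.

Lemma csystem_le_compact_graph a d (f : forall X, cspace d X -> cspace a X) :
  (forall X, dominates (@cincl G d X) (@cincl G a X) (f X)) ->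
  (forall X X' (XX' : (X `<=` X')%fset), f X \o cbond d XX' = cbond a XX' \o f X') ->
  exists F : compact_graph R d -> compact_graph R a,
    [/\ dominates (@compact_graph_incl R G d) (@compact_graph_incl R G a) F,
        forall q, F (inl q) = inl q &
        forall x, exists2 y, F (inr x) = inr y &
          forall X, coordinate y X = f X (coordinate x X)].
Proof.
move=> fd fb.
have fi X (C : component X) : f X (cincl d C) = cincl a C.
  by have [_ <-] := fd X.
have yP (x : climit d) X X' (XX' : (X `<=` X')%fset) :
    cbond a XX' (f X' (coordinate x X')) = f X (coordinate x X).
  by rewrite -(coordinateP x XX'); exact: (esym (congr1 (@^~ _) (fb _ _ XX'))).
pose fl (x : climit d) : climit a := InverseLimit (yP x).
pose F (p : compact_graph R d) : compact_graph R a :=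
  match p with inl q => inl q | inr x => inr (fl x) end.
exists F; split=> //; last by move=> x; exists (fl x).
split; last first.
  apply/funext => -[q//|w] /=; congr inr; apply: inverse_limit_inj => X /=.
  exact: fi.
move=> p; have FF := fmap_filter F (nbhs_filter p).
apply: generated_cvg => A sA Ap.
change (nbhs p (F @^-1` A)); apply: open_nbhs_nbhs; split=> //.
case: sA => [[U oU <-]|[X [O [oO ->]]]]; apply: generated_open.
  left; exists U => //; apply/seteqP; split=> [_ [q Uq <-]|]; first by exists q.
  by move=> [q [r Ur [<-]]|x [r _]//]; exists r.
(* The preimage of the subbasic set given by [X] and [O] is the one given by [X] and the preimage of
   [O]: the parts in the graph agree because [f X] fixes components. *)
right; exists X, (f X @^-1` O); split.
  by apply: open_comp oO => x _; have [cf _] := fd X; exact: cf.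
have -> : cincl d (X := X) @^-1` (f X @^-1` O) = cincl a (X := X) @^-1` O.
  by apply/funext => C; rewrite /preimage /= fi.
apply/seteqP; split.
  move=> [q [[r rt [<-]]|[y _]//]|x [[r _]//|[y Oy [E]]]].
    by left; exists r.
  by right; exists x => //; move: Oy; rewrite E.
by move=> _ [[r rt <-]|[x Ox <-]]; [left; exists r|right; exists (fl x)].
Qed.

(** Components are dense in the Hausdorff space [cspace a X]. Applied to both composites of two
    opposite morphisms, this makes them mutually inverse. *)
Lemma csystem_morphism_id a (h : forall X, cspace a X -> cspace a X) :
  (forall X, continuous (h X)) ->
  (forall X (C : component X), h X (cincl a C) = cincl a C) ->
  forall X x, h X x = x.
Proof.
move=> ch hi X x; have [_ _ dX] := @cincl_compactification G a X.
suff -> : h X = id by [].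
apply: (eq_on_dense (@cspace_hausdorff G a X) dX (ch X)).
  by move=> y; exact: cvg_id.
by move=> y; rewrite inE => -[C _ <-]; exact: hi.
Qed.

Lemma csystem_equivalent_compact_graph a d : csystem_equivalent a d ->
  topologically_equivalent (@compact_graph_incl R G a) (@compact_graph_incl R G d).
Proof.
move=> [[f [fd fb]] [g [gd gb]]].
have fi X (C : component X) : f X (cincl d C) = cincl a C.
  by have [_ <-] := fd X.
have gi X (C : component X) : g X (cincl a C) = cincl d C.
  by have [_ <-] := gd X.
have fg X x : f X (g X x) = x.
  apply: (csystem_morphism_id (h := fun X => f X \o g X)).
    move=> Z y; apply: continuous_comp; first by have [cg _] := gd Z; exact: cg.
    by have [cf _] := fd Z; exact: cf.
  by move=> Z C /=; rewrite gi fi.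
have gf X x : g X (f X x) = x.
  apply: (csystem_morphism_id (h := fun X => g X \o f X)).
    move=> Z y; apply: continuous_comp; first by have [cf _] := fd Z; exact: cf.
    by have [cg _] := gd Z; exact: cg.
  by move=> Z C /=; rewrite fi gi.
have [F [Fd Fl Fr]] := csystem_le_compact_graph fd fb.
have [H [Hd Hl Hr]] := csystem_le_compact_graph gd gb.
exists F; split=> //; split; first by have [] := Fd.
exists H; split; first by have [] := Hd.
  move=> [q|x]; first by rewrite Fl Hl.
  have [y -> yE] := Fr x; have [z -> zE] := Hr y; congr inr.
  by apply: inverse_limit_inj => X; rewrite zE yE gf.
move=> [q|x]; first by rewrite Hl Fl.
have [y -> yE] := Hr x; have [z -> zE] := Fr y; congr inr.
by apply: inverse_limit_inj => X; rewrite zE yE fg.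
Qed.

End Functoriality.
End CSystemMorphisms.

(** * Critical sets as points at infinity *)

Section CriticalPoints.
Variable G : graph.
Implicit Types X Y : {fset G}.

(** The components of [G - X] are sorted by their neighbourhoods into finitely many classes, one for
    each subset of [X]; if there are infinitely many components, one class is infinite. *)
Lemma not_tough_critical : ~ tough G -> exists Y, critical Y.
Proof.
move=> nt; apply: contrapT => nc; apply: nt => X.
have : finite_set (\bigcup_(Y in [set` fpowerset X]) components_at X Y).
  apply: bigcup_finite; first exact: finite_fset.
  move=> Y /=; rewrite fpowersetE => YX; apply: contrapT => inf.
  by apply: nc; exists Y; exact: infinite_critical YX inf.
apply: sub_finite_set => C _; have [Y YX NC] := components_atP C.
by exists Y => //=; rewrite fpowersetE.
Qed.

Variables (Y : {fset G}) (cY : critical Y).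

Lemma crit_point_subproof X X' (XX' : (X `<=` X')%fset) :
  gamma_bond XX' (gamma_bond (fsubsetUl X' Y)
    (inr (CritIn (fsubsetUr X' Y) cY))) =
  gamma_bond (fsubsetUl X Y) (inr (CritIn (fsubsetUr X Y) cY)).
Proof.
(* Both sides are the image of the point [Y] at level [X' ∪ Y]; on the right it passes through level
   [X ∪ Y]. *)
have ZZ' : (X `|` Y `<=` X' `|` Y)%fset by exact: fsetSU.
have XZ' : (X `<=` X' `|` Y)%fset := fsubset_trans XX' (fsubsetUl X' Y).
rewrite (gamma_bond_comp _ _ XZ').
rewrite -(gamma_bond_comp (fsubsetUl X Y) ZZ').
by congr (gamma_bond _ _); apply: gamma_bond_in.
Qed.

(* Going through [X `|` Y] yields [Y] itself if [Y] is a subset of [X] and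
   [C_X(Y)] otherwise, without a case distinction. *)
Definition crit_point : climit (gamma_system G) :=
  @InverseLimit G _ (@cbond G (gamma_system G)) _ crit_point_subproof.

(** Its coordinate at [Y] is the critical set [Y] itself, not a component. *)
Lemma crit_point_not_end : ~ range (end_incl (gamma_system G)) crit_point.
Proof.
move=> [w _ wE]; pose Z := CritIn (fsubset_refl Y) cY.
have : coordinate crit_point Y = inr Z by exact: gamma_bond_in.
by rewrite -wE.
Qed.

(** The sets containing all but finitely many components of the class of [Z] form a filter, so
    convergence to [Z] need only be tested on the subbase. *)
Lemma gamma_nbhs_cofinite X (Z : crit_in X) (O : set (gamma_space X)) :
  open O -> O (inr Z) ->
  finite_set (components_at X (crit_set Z) `\` (inl @^-1` O)).
Proof.
move=> oO OZ.
pose F : set_system (gamma_space X) :=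
  [set A | finite_set (components_at X (crit_set Z) `\` (inl @^-1` A))].
have FF : Filter F.
  split=> [|A B FA FB|A B AB FA].
  - by rewrite /F/= preimage_setT setDT; exact: finite_set0.
  - by rewrite /F/= preimage_setI setDIr finite_setU.
  - by apply: sub_finite_set FA => C [NC nB]; split=> // AC; apply/nB/AB.
suff : F --> (inr Z : gamma_space X) by apply; exact: open_nbhs_nbhs.
apply: gamma_cvg => A [[B _ <-] []//|[Z' [CC [_ fCC ->]]] [[]//|[ZZ']]].
subst Z'; apply: sub_finite_set fCC => C [NC nA]; split=> // CCC.
by apply: nA; left; exists C.
Qed.

(** At level [X ∪ Y] the point is represented by [Y] itself, so [gamma_nbhs_cofinite] applies there.
    A component of [G - Y] with neighbourhood [Y] that avoids [X] is also a component at that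
    level. *)
Lemma crit_point_cofinite X (O : set (gamma_space X)) :
  open O -> O (coordinate crit_point X) ->
  finite_set (components_at Y Y `\`
    [set C | cset C `<=` vertex_union [set D : component X | O (inl D)]]).
Proof.
move=> oO Oy; pose Z := (X `|` Y)%fset.
pose O' : set (gamma_space Z) := gamma_bond (fsubsetUl X Y) @^-1` O.
have oO' : open O'.
  by apply: open_comp oO => x _; exact: gamma_bond_continuous.
pose bad := components_at Z Y `\` (inl @^-1` O').
have fbad : finite_set bad := gamma_nbhs_cofinite oO' Oy.
(* An exceptional component meets [Z] or has the vertex set of a bad component of [G - Z]. *)
apply: (sub_finite_set (B := [set C : component Y | exists2 x, x \in Z & cset C x]
  `|` @cset G Y @^-1` (@cset G Z @` bad))); last first.
  rewrite finite_setU; split; first exact: finite_components_meeting.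
  apply: finite_preimage; first by move=> C D _ _; exact: component_inj.
  exact: finite_image.
move=> C [NC nC].
have [?|CZ] := pselect (exists2 x, x \in Z & cset C x); [by left|right].
have [D ND DC] : exists2 D : component Z, components_at Z Y D & cset D = cset C.
  apply: component_transfer NC (fsubsetUr X Y) _ => z zZ Cz.
  by apply: CZ; exists z.
exists D => //; split=> // OD; apply: nC => v Cv.
exists (component_map (fsubsetUl X Y) D) => //.
by apply: component_map_sub; rewrite DC.
Qed.

(** * The two compactifications differ if there is a critical set *)

Section Compactification.
Variable R : realType.

Lemma tail_union_vtx X (CC : set (component X)) v :
  tail_union CC (Vtx R v) -> vertex_union CC v.
Proof. by move=> [[[w wC [<-]]|[e [t [_]]]]|[e [t [_]]]]. Qed.

(** The sets [S] with this cofiniteness property form a filter, so subbasic neighbourhoods suffice;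
    those are tails, covered by [crit_point_cofinite]. *)
Lemma crit_point_nbhs (S : set (compact_graph R (gamma_system G))) :
  nbhs (inr crit_point : compact_graph R (gamma_system G)) S ->
  finite_set (components_at Y Y `\`
    [set C | forall v, cset C v -> S (inl (Vtx R v))]).
Proof.
pose F : set_system (compact_graph R (gamma_system G)) :=
  [set S | finite_set (components_at Y Y `\`
    [set C | forall v, cset C v -> S (inl (Vtx R v))])].
have FF : Filter F.
  split=> [|A B FA FB|A B AB FA].
  - apply: sub_finite_set (finite_set0 (component Y)) => C [_ nC].
    by apply: nC => v _.
  - have : finite_set (components_at Y Y `\`
        [set C | forall v, cset C v -> A (inl (Vtx R v))] `|`
        components_at Y Y `\`
        [set C | forall v, cset C v -> B (inl (Vtx R v))]).
      by rewrite finite_setU.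
    apply: sub_finite_set => C [NC nC].
    have [CA|CA] := pselect (forall v, cset C v -> A (inl (Vtx R v))).
      right; split=> // CB; apply: nC => v Cv.
      by split; [exact: CA|exact: CB].
    by left.
  - apply: sub_finite_set FA => C [NC nC]; split=> // CA; apply: nC => v Cv.
    exact/AB/CA.
have FY : F --> (inr crit_point : compact_graph R (gamma_system G)).
  apply: generated_cvg => A [[U _ <-] []//|[X [O [oO ->]]] [[]//|[x Ox [xE]]]].
  rewrite xE in Ox.
  apply: sub_finite_set (crit_point_cofinite oO Ox) => C [NC nC].
  split=> // CO; apply: nC => v /CO vO; left; exists (Vtx R v) => //.
  by left; left; exists v.
exact: FY.
Qed.

Lemma critical_not_equivalent :
  ~ topologically_equivalent
      (@compact_graph_incl R G (gamma_system G))
      (@compact_graph_incl R G (ultra_system G)).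
Proof.
move=> [f [[_ fi] [_ [g [cg gK fK]]]]].
have fl q : f (inl q) = inl q := congr1 (@^~ (inl q)) fi.
have gl q : g (inl q) = inl q by rewrite -[inl q in LHS]fl gK.
(* The inverse homeomorphism [g] cannot send [crit_point] to a point [q] of the graph, since [f]
   fixes such points. *)
case gy : (g (inr crit_point)) => [q|w].
  by have := fK (inr crit_point); rewrite gy fl.
pose u : ultrafilter_on (component Y) := coordinate w Y.
(* If [u] contained the complement of [A], the tail over that complement would be a neighbourhood of
   [g (inr crit_point)]. By continuity it would contain all vertices of all but finitely many
   components in [components_at Y Y], yet it contains no vertex of a component in [A]. *)
have sep (A : set (component Y)) : A `<=` components_at Y Y -> infinite_set A ->
    ~ uset u (~` A).
  move=> AY iA uA.
  pose W : set (compact_graph R (ultra_system G)) :=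
    inl @` tail_union (ultra_incl (X := Y) @^-1` beta_basic (~` A)) `|`
    inr @` [set x : climit (ultra_system G) | beta_basic (~` A) (coordinate x Y)].
  have nW : nbhs (g (inr crit_point)) W.
    rewrite gy; apply: open_nbhs_nbhs; split; last by right; exists w.
    apply: generated_open; right; exists Y, (beta_basic (~` A)); split=> //.
    exact: beta_basic_open.
  apply: iA; apply: sub_finite_set (crit_point_nbhs (cg _ _ nW)) => C AC.
  split=> [|CW]; first exact: AY.
  have [v Cv] := component_neq0 C.
  have := CW _ Cv; rewrite /preimage /= gl => -[[q qt [qE]]|[x _]//].
  rewrite qE in qt; have [D DA Dv] := tail_union_vtx qt.
  by move/beta_inclE: DA; apply; rewrite -(component_eq Cv Dv).
(* By [sep], two disjoint infinite parts of the class would both belong to [u]. *)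
have [A [B [AY BY iA iB AB]]] := infinite_split cY.
have uP := ultra_proper_uset u.
have uA : uset u A by apply: contrapT => /uset_setC; exact: sep.
have uB : uset u B by apply: contrapT => /uset_setC; exact: sep.
have /filter_ex[C] : uset u (A `&` B) by exact: filterI.
by rewrite AB.
Qed.

End Compactification.
End CriticalPoints.

Theorem theorem7p8 (R : realType) (G : graph) :
  [<-> topologically_equivalent
         (@compact_graph_incl R G (gamma_system G))
         (@compact_graph_incl R G (ultra_system G));
       csystem_equivalent (gamma_system G) (ultra_system G);
       tough G;
       range (@end_incl G (gamma_system G)) = [set: climit (gamma_system G)] /\
       range (@end_incl G (ultra_system G)) = [set: climit (ultra_system G)] ].
Proof.
have tough_equiv : tough G ->
    csystem_equivalent (gamma_system G) (ultra_system G).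
  by move=> tG; split; exact: tough_csystem_le.
have equiv_tough : topologically_equivalent
    (@compact_graph_incl R G (gamma_system G))
    (@compact_graph_incl R G (ultra_system G)) -> tough G.
  move=> eqv; apply: contrapT => /not_tough_critical[Y cY].
  exact: critical_not_equivalent cY R eqv.
tfae.
- by move=> /equiv_tough /tough_equiv.
- by move=> /(csystem_equivalent_compact_graph R) /equiv_tough.
- by move=> tG; split; exact: tough_end_incl_surj.
(* Toughness is recovered first: a critical set would give a point of the limit of [gamma_system G]
   that is not an end. *)
- move=> [surj _]; apply/csystem_equivalent_compact_graph/tough_equiv.
  apply: contrapT => /not_tough_critical[Y cY].
  by apply: (@crit_point_not_end _ _ cY); rewrite surj.
Qed.
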